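(* Assume that $T_\psi$ is transitive. Let $f : \Sigma^+ \to \mathbb R$ be Hölder continuous. If $G$ is amenable then \[ P_{\mathrm{Gur}}(f,T_\psi) = P_{\mathrm{Gur}}(f,T_{\psi^{\mathrm{ab}}}) . \]
   Context: Let $\sigma:\Sigma^+\to\Sigma^+$ be a topologically mixing one-sided subshift of finite type, $G$ a countable group with identity $e$, and $\psi:\Sigma^+\to G$ depending only on two coordinates, $\psi(x)=\psi(x_0,x_1)$. The skew product is $T_\psi:\Sigma^+\times G\to\Sigma^+\times G$, $T_\psi(x,g)=(\sigma x,g\psi(x))$, with $\psi^n(x)=\psi(x)\psi(\sigma x)\cdots\psi(\sigma^{n-1}x)$. Let $G^{\mathrm{ab}}=G/[G,G]$, $\pi:G\to G^{\mathrm{ab}}$ the projection, $\psi^{\mathrm{ab}}=\pi\circ\psi$, and $T_{\psi^{\mathrm{ab}}}$ the induced $G^{\mathrm{ab}}$-extension. The function $f$ is also regarded as a function on $\Sigma^+\times G$ and $\Sigma^+\times G^{\mathrm{ab}}$ via $f(x,g)=f(x)$. The Gurevič pressure of $f$ for the extension is $P_{\mathrm{Gur}}(f,T_\psi)=\limsup_{n\to\infty}\frac1n\log\sum_{\sigma^nx=x,\ \psi^n(x)=e}e^{f^n(x)}$, where $f^n=f+f\circ\sigma+\dots+f\circ\sigma^{n-1}$, and analogously for $T_{\psi^{\mathrm{ab}}}$ (with the identity of $G^{\mathrm{ab}}$). *)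

(* Defs.v *)
From HB Require Import structures.
From mathcomp Require Import all_boot all_order all_algebra.
From mathcomp Require Import all_classical all_reals all_analysis.
Set Implicit Arguments. Unset Strict Implicit. Unset Printing Implicit Defensive.
Import Order.TTheory GRing.Theory Num.Theory.
Local Open Scope ring_scope.

Record is_group (G : Type) (mul : G -> G -> G) (inv : G -> G) (e : G) : Prop := {
  grp_assoc : forall a b c, mul a (mul b c) = mul (mul a b) c;
  grp_mul1 : forall a, mul e a = a;
  grp_mulg1 : forall a, mul a e = a;
  grp_mulV : forall a, mul (inv a) a = e;
  grp_mulgV : forall a, mul a (inv a) = e }.

Definition gcomm (G : Type) (mul : G -> G -> G) (inv : G -> G) (a b : G) : G :=
  mul (inv a) (mul (inv b) (mul a b)).

Definition in_commutator_subgroup (G : Type) (mul : G -> G -> G) (inv : G -> G)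
  (e : G) (g : G) : Prop :=
  exists s : seq (G * G), g = foldr (fun p acc => mul (gcomm mul inv p.1 p.2) acc) e s.

Definition bounded_fun (R : realType) (G : Type) (phi : G -> R) : Prop :=
  exists M : R, forall g, `|phi g| <= M.

Definition amenable (R : realType) (G : Type) (mul : G -> G -> G) (inv : G -> G) : Prop :=
  exists m : (G -> R) -> R,
    [/\ (forall phi1 phi2, bounded_fun phi1 -> bounded_fun phi2 ->
           m (fun g => phi1 g + phi2 g) = m phi1 + m phi2),
        (forall (c : R) phi, bounded_fun phi -> m (fun g => c * phi g) = c * m phi),
        (forall phi, bounded_fun phi -> (forall g, 0 <= phi g) -> 0 <= m phi),
        m (fun _ => 1) = 1 &
        (forall a phi, bounded_fun phi -> m (fun h => phi (mul (inv a) h)) = m phi)].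

Definition in_sft (k : nat) (A : rel 'I_k) (x : nat -> 'I_k) : Prop :=
  forall n, A (x n) (x n.+1).

Definition shiftn (k : nat) (n : nat) (x : nat -> 'I_k) : nat -> 'I_k :=
  fun i => x (i + n)%N.

Definition in_cyl (k : nat) (m : nat) (u : nat -> 'I_k) (x : nat -> 'I_k) : Prop :=
  forall i, (i < m)%N -> x i = u i.

(* topological mixing, tested on the basis of cylinder sets *)
Definition topologically_mixing (k : nat) (A : rel 'I_k) : Prop :=
  forall m u m' v,
    (exists x, in_sft A x /\ in_cyl m u x) ->
    (exists y, in_sft A y /\ in_cyl m' v y) ->
    exists N, forall n, (N <= n)%N ->
      exists x, [/\ in_sft A x, in_cyl m u x & in_cyl m' v (shiftn n x)].

(* Hölder continuity w.r.t. the metric d(x,y) = theta^{min{n : x_n <> y_n}} *)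
Definition holder (R : realType) (k : nat) (A : rel 'I_k) (f : (nat -> 'I_k) -> R) : Prop :=
  exists (C theta : R), 0 < theta < 1 /\
    forall n x y, in_sft A x -> in_sft A y ->
      (forall i, (i < n)%N -> x i = y i) -> `|f x - f y| <= C * theta ^+ n.

Definition birkhoff (R : realType) (k : nat) (f : (nat -> 'I_k) -> R) (n : nat)
  (x : nat -> 'I_k) : R := \sum_(i < n) f (shiftn i x).

Fixpoint cocycle (k : nat) (G : Type) (mul : G -> G -> G) (e : G)
  (psi : 'I_k -> 'I_k -> G) (n : nat) (x : nat -> 'I_k) : G :=
  match n with
  | 0 => e
  | n'.+1 => mul (psi (x 0%N) (x 1%N)) (cocycle mul e psi n' (shiftn 1 x))
  end.

(* topological transitivity of T_psi on Sigma^+ x G (G discrete), tested on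
   the basis of open sets [u] x {g} *)
Definition skew_transitive (k : nat) (A : rel 'I_k) (G : Type) (mul : G -> G -> G)
  (e : G) (psi : 'I_k -> 'I_k -> G) : Prop :=
  forall m u (g : G) m' v (h : G),
    (exists x, in_sft A x /\ in_cyl m u x) ->
    (exists y, in_sft A y /\ in_cyl m' v y) ->
    exists n x, [/\ in_sft A x, in_cyl m u x, in_cyl m' v (shiftn n x)
                  & mul g (cocycle mul e psi n x) = h].

Definition periodic_ext (k n : nat) (w : {ffun 'I_n.+1 -> 'I_k}) : nat -> 'I_k :=
  fun i => w (Ordinal (ltn_pmod i (ltn0Sn n))).

(* sum_{sigma^{n+1} x = x, x in Sigma^+, psi^{n+1}(x) in H} exp(f^{n+1}(x)).
   Points x in Sigma^+ with sigma^{n+1} x = x are in bijection with words w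
   of length n+1 whose periodic extension lies in Sigma^+. *)
Definition periodic_sum (R : realType) (k : nat) (A : rel 'I_k) (G : Type)
  (mul : G -> G -> G) (e : G) (psi : 'I_k -> 'I_k -> G) (H : G -> Prop)
  (f : (nat -> 'I_k) -> R) (n : nat) : R :=
  \sum_(w : {ffun 'I_n.+1 -> 'I_k} |
          `[< in_sft A (periodic_ext w) /\ H (cocycle mul e psi n.+1 (periodic_ext w)) >])
     expR (birkhoff f n.+1 (periodic_ext w)).

(* Gurevic pressure restricted to cocycle values in H, with log 0 = -oo:
   limsup_n (1/n) log (sum ...), as an extended real *)
Definition gurevic_pressure_in (R : realType) (k : nat) (A : rel 'I_k) (G : Type)
  (mul : G -> G -> G) (e : G) (psi : 'I_k -> 'I_k -> G) (H : G -> Prop)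
  (f : (nat -> 'I_k) -> R) : \bar R :=
  limn_esup (fun n : nat =>
    let Z := periodic_sum A mul e psi H f n in
    if 0 < Z then ((ln Z) / n.+1%:R)%:E else -oo%E).

Definition gurevic_pressure (R : realType) (k : nat) (A : rel 'I_k) (G : Type)
  (mul : G -> G -> G) (e : G) (psi : 'I_k -> 'I_k -> G)
  (f : (nat -> 'I_k) -> R) : \bar R :=
  gurevic_pressure_in A mul e psi (fun g => g = e) f.

(* P_Gur(f, T_{psi^ab}): pi(psi^n x) = identity of G^ab  iff  psi^n x in [G,G] *)
Definition gurevic_pressure_ab (R : realType) (k : nat) (A : rel 'I_k) (G : Type)
  (mul : G -> G -> G) (inv : G -> G) (e : G) (psi : 'I_k -> 'I_k -> G)
  (f : (nat -> 'I_k) -> R) : \bar R :=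
  gurevic_pressure_in A mul e psi (in_commutator_subgroup mul inv e) f.

(* Main.v *)
Require Import Defs.
From mathcomp Require Import all_boot all_order all_algebra.
From mathcomp Require Import all_classical all_reals all_analysis.
From mathcomp Require Import lra zify.
Set Implicit Arguments. Unset Strict Implicit. Unset Printing Implicit Defensive.
Import Order.TTheory GRing.Theory Num.Theory.
Import numFieldNormedType.Exports.
Local Open Scope classical_set_scope.
Local Open Scope ring_scope.

(* Weight a periodic word by the exponential of its Birkhoff sum and let Z_n(g)
   be the total weight of the loops of length n at a fixed symbol with cocycle
   value g. Bounded distortion gives, with K independent of m and n,
     sum_s Z_m(s) Z_n(s^-1 g) <= K Z_(m+n)(g).
   For t above the Gurevich pressure the series H(g) = sum_n e^(-tn) Z_n(g)
   converges by transitivity, is positive, and satisfies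
     sum_s Z_m(s) H(s^-1 g) <= K e^(tm) H(g)      for all m.
   Averaging ln H(s^-1 g) - ln H(g) over g with an invariant mean produces a
   homomorphism chi from G to the reals, and Jensen's inequality yields
     sum_s Z_m(s) e^(chi(s)) <= K e^(tm).
   Since chi vanishes on [G,G], the loops with value in [G,G] have total weight
   at most K e^(tm), so the pressure of the abelianized extension is at most t. *)

(** * Group identities, and additive functions on commutators *)

Section Group.
Variables (G : Type) (mul : G -> G -> G) (inv : G -> G) (e : G).
Hypothesis grp : is_group mul inv e.

Lemma mulKg a b : mul (inv a) (mul a b) = b.
Proof. by rewrite (grp_assoc grp) (grp_mulV grp) (grp_mul1 grp). Qed.

Lemma mulKVg a b : mul a (mul (inv a) b) = b.
Proof. by rewrite (grp_assoc grp) (grp_mulgV grp) (grp_mul1 grp). Qed.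

Lemma invgK a : inv (inv a) = a.
Proof. by rewrite -[RHS](mulKg (inv a)) (grp_mulV grp) (grp_mulg1 grp). Qed.

Lemma invMg a b : inv (mul a b) = mul (inv b) (inv a).
Proof.
rewrite -[RHS](mulKg (mul a b)) -(grp_assoc grp) mulKVg (grp_mulgV grp).
by rewrite (grp_mulg1 grp).
Qed.

(** The target is commutative, so [chi] cancels on every [gcomm] factor. *)
Lemma additive_commutator0 (V : zmodType) (chi : G -> V) g :
  (forall a b, chi (mul a b) = chi a + chi b) ->
  in_commutator_subgroup mul inv e g -> chi g = 0.
Proof.
move=> chiM [s ->].
have chi1 : chi e = 0.
  by apply: (@addrI _ (chi e)); rewrite -chiM (grp_mul1 grp) addr0.
have chiV a : chi (inv a) = - chi a.
  by apply: (@addrI _ (chi a)); rewrite -chiM (grp_mulgV grp) subrr.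
elim: s => [|[a b] s IHs] //=.
by rewrite chiM IHs /gcomm /= !chiM !chiV addr0 addrCA addKr addNr.
Qed.

End Group.

(** * Invariant means and Jensen's inequality *)

Local Notation bounded_fun := Defs.bounded_fun.

Section Mean.
Variables (R : realType) (G : Type) (mul : G -> G -> G) (inv : G -> G) (e : G).
Hypothesis grp : is_group mul inv e.

Lemma bounded_funD (f g : G -> R) :
  bounded_fun f -> bounded_fun g -> bounded_fun (fun x => f x + g x).
Proof.
move=> [M Mf] [N Ng]; exists (M + N) => x.
by rewrite (le_trans (ler_normD _ _))// lerD.
Qed.

Lemma bounded_funZ (c : R) (f : G -> R) :
  bounded_fun f -> bounded_fun (fun x => c * f x).
Proof.
move=> [M Mf]; exists (`|c| * M) => x.
by rewrite normrM ler_wpM2l.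
Qed.

Lemma bounded_cst (c : R) : bounded_fun (fun _ : G => c).
Proof. by exists `|c|. Qed.

Lemma bounded_fun_sum (I : Type) (r : seq I) (F : I -> G -> R) :
  (forall i, bounded_fun (F i)) -> bounded_fun (fun x => \sum_(i <- r) F i x).
Proof.
move=> bF; elim: r => [|i r IHr].
  by rewrite (_ : (fun _ => _) = fun=> 0); [exact: bounded_cst|
    apply/funext => x; rewrite big_nil].
rewrite (_ : (fun _ => _) = fun x => F i x + \sum_(j <- r) F j x).
  exact: bounded_funD.
by apply/funext => x; rewrite big_cons.
Qed.

(* The logarithmic increments of [H], averaged by the invariant mean, form a
   homomorphism to the reals; Jensen's inequality transfers to it the
   superharmonicity inequalities satisfied by [H]. *)
Lemma amenable_exponential_minorant (H : G -> R) :
  amenable R mul inv ->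
  (forall g, 0 < H g) ->
  (forall s, exists C, forall g, H (mul (inv s) g) <= C * H g) ->
  exists chi : G -> R, (forall a b, chi (mul a b) = chi a + chi b) /\
    forall (I : finType) (p : I -> G) (c : I -> R) (B : R),
      (forall i, 0 <= c i) ->
      (forall g, \sum_i c i * H (mul (inv (p i)) g) <= B * H g) ->
      \sum_i c i * expR (chi (p i)) <= B.
Proof.
move=> [M [MD MZ M0 M1 Minv]] H0 HC.
have Mcst c : M (fun=> c) = c.
  rewrite -[RHS]mulr1 -M1 -MZ; last exact: bounded_cst.
  by congr M; apply/funext => x; rewrite mulr1.
have Mle f g : bounded_fun f -> bounded_fun g -> (forall x, f x <= g x) ->
    M f <= M g.
  move=> bf bg fg; rewrite -subr_ge0 -mulN1r -MZ// -MD//; last exact: bounded_funZ.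
  apply: M0; first by apply: bounded_funD => //; exact: bounded_funZ.
  by move=> x; rewrite mulN1r subr_ge0.
have Msum (I : finType) (F : I -> G -> R) : (forall i, bounded_fun (F i)) ->
    M (fun x => \sum_i F i x) = \sum_i M (F i).
  move=> bF; elim: (index_enum I) => [|i r IHr].
    by rewrite big_nil -[RHS]Mcst; congr M; apply/funext => x; rewrite big_nil.
  rewrite big_cons -IHr -MD//; last exact: bounded_fun_sum.
  by congr M; apply/funext => x; rewrite big_cons.
have Jensen f : bounded_fun f -> bounded_fun (fun x => expR (f x)) ->
    expR (M f) <= M (fun x => expR (f x)).
  move=> bf bef; set m := M f.
  (* The tangent line of exp at [m], composed with [f]: it lies below exp and its mean is
     [expR m]. *)
  have bh : bounded_fun (fun x => expR m * (f x + (1 - m))).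
    by apply: bounded_funZ; apply: bounded_funD => //; exact: bounded_cst.
  have <- : M (fun x => expR m * (f x + (1 - m))) = expR m.
    rewrite MZ; last by apply: bounded_funD => //; exact: bounded_cst.
    by rewrite MD//; [rewrite Mcst -/m addrC subrK mulr1|exact: bounded_cst].
  apply: Mle => // x.
  rewrite -[in leRHS](subrK m (f x)) expRD [leRHS]mulrC ler_pM2l ?expR_gt0//.
  by rewrite (le_trans _ (expR_ge1Dx _))// addrCA.
pose F s g := ln (H (mul (inv s) g)) - ln (H g).
have FE s g : expR (F s g) = H (mul (inv s) g) / H g.
  by rewrite expRD expRN !lnK// posrE.
have ubF s : exists2 D, 0 < D & forall g, H (mul (inv s) g) / H g <= D.
  have [C hC] := HC s; exists (Num.max C 1); first by rewrite lt_max ltr01 orbT.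
  by move=> g; rewrite ler_pdivrMr// (le_trans (hC g))// ler_pM2r// le_max lexx.
have bFe s : bounded_fun (fun g => expR (F s g)).
  have [D D0 hD] := ubF s; exists D => g.
  by rewrite ger0_norm ?expR_ge0// FE.
have bF s : bounded_fun (F s).
  have [D D0 hD] := ubF s; have [D' D'0 hD'] := ubF (inv s).
  have u1 g : F s g <= ln D by rewrite -ler_expR FE lnK ?posrE.
  (* The lower bound on [F s] is the upper ratio bound for [inv s], taken at the point
     [mul (inv s) g]. *)
  have u2 g : - F s g <= ln D'.
    rewrite -ler_expR expRN FE lnK ?posrE// invf_div.
    by have := hD' (mul (inv s) g); rewrite (invgK grp) (mulKVg grp).
  exists (`|ln D| + `|ln D'|) => g.
  have := u1 g; have := u2 g; have := ler_norm (ln D); have := ler_norm (ln D').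
  have := normr_ge0 (ln D); have := normr_ge0 (ln D').
  rewrite ler_norml; lra.
exists (fun s => M (F s)); split=> [a b|I p c B c0 hB].
  (* Additivity comes from [F (mul a b) g = F b (mul (inv a) g) + F a g]; invariance of the mean
     removes the translation by [a]. *)
  rewrite -[M (F b)](Minv a)// addrC -MD//; last first.
    have [N hN] := bF b; by exists N.
  congr M; apply/funext => g.
  by rewrite /F (invMg grp) -(grp_assoc grp) addrA subrK.
have bcF i : bounded_fun (fun g => c i * expR (F (p i) g)).
  exact: bounded_funZ.
apply: (@le_trans _ _ (M (fun g => \sum_i c i * expR (F (p i) g)))).
  rewrite Msum//; apply: ler_sum => i _.
  by rewrite MZ// ler_wpM2l// Jensen.
rewrite -[leRHS]Mcst; apply: Mle; [exact: bounded_fun_sum|exact: bounded_cst|].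
move=> g; rewrite -(ler_pM2r (H0 g)) mulr_suml (le_trans _ (hB g))//.
by apply: ler_sum => i _; rewrite FE -mulrA divfK// gt_eqF.
Qed.

End Mean.

(** * Green series of weighted words with values in an amenable group *)

(* Index [n] stands for words of length [n.+1], hence the [(m + n).+1] below. *)
Section WeightedWords.
Variables (R : realType) (G : eqType) (mul : G -> G -> G) (inv : G -> G) (e : G).
Hypothesis grp : is_group mul inv e.
Variables (W : nat -> finType) (p : forall n, W n -> G) (c : forall n, W n -> R).
Variables (K rho B : R).
Hypothesis c0 : forall n (w : W n), 0 <= c w.
Hypothesis K0 : 0 < K.
Hypothesis rho0 : 0 < rho.

Let Z n g := \sum_(w : W n | p w == g) c w.
(** Truncated Green series, with [rho] in the role of e^(-t). *)
Let green N g := \sum_(n < N) rho ^+ n.+1 * Z n g.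

Hypothesis supermul : forall m n g,
  \sum_(u : W m) c u * Z n (mul (inv (p u)) g) <= K * Z (m + n).+1 g.
Hypothesis full : forall g, exists n (w : W n), p w = g /\ 0 < c w.
Hypothesis green_bounded : forall N, green N e <= B.

Let Z0 n g : 0 <= Z n g. Proof. by apply: sumr_ge0. Qed.

Let greenZ0 n g : 0 <= rho ^+ n.+1 * Z n g.
Proof. by rewrite mulr_ge0// exprn_ge0// ltW. Qed.

Let green_nd g : {homo green^~ g : n m / (n <= m)%N >-> n <= m}.
Proof.
apply/nondecreasing_seqP => N.
by rewrite /green big_ord_recr /= lerDl.
Qed.

(** Convolution with the words of index [m] shifts the series by [m.+1] terms, by [supermul]. The
    first [m.+1] terms on the right are nonnegative and are dropped. *)
Let green_superharmonic m N g :
  \sum_(u : W m) rho ^+ m.+1 * c u * green N (mul (inv (p u)) g)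
    <= K * green (m + N).+1 g.
Proof.
rewrite /green.
under eq_bigr do rewrite mulr_sumr.
rewrite exchange_big /= -addSn big_split_ord /= mulrDr.
rewrite -[leLHS]add0r lerD//.
  by rewrite mulr_ge0 ?(ltW K0)//; apply: sumr_ge0.
rewrite mulr_sumr; apply: ler_sum => n _.
rewrite mulrCA addSn.
under eq_bigr do rewrite mulrACA -exprD.
by rewrite -mulr_sumr addnS addSn ler_pM2l ?exprn_gt0.
Qed.

(** Boundedness is assumed at [e] only. A word [w] of value [inv g] and positive weight carries it
    to [g]: keep the term of [w] alone in the superharmonic inequality at [e]. *)
Let green_cvg g : cvgn (green^~ g).
Proof.
apply: nondecreasing_is_cvgn => //.
have [m [w [pw cw]]] := full (inv g).
have a0 : 0 < rho ^+ m.+1 * c w by rewrite mulr_gt0 ?exprn_gt0.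
exists (K * B / (rho ^+ m.+1 * c w)) => _ [N _ <-].
rewrite ler_pdivlMr// mulrC.
apply: (@le_trans _ _ (K * green (m + N).+1 e)); last by rewrite ler_pM2l.
apply: le_trans (green_superharmonic _ _ _).
rewrite (bigD1 w)//= pw (invgK grp) (grp_mulg1 grp) lerDl.
apply: sumr_ge0 => u _; rewrite !mulr_ge0 ?exprn_ge0 ?(ltW rho0)//.
exact: sumr_ge0.
Qed.

Let H g := limn (green^~ g).

Let H_superharmonic m g :
  \sum_(u : W m) rho ^+ m.+1 * c u * H (mul (inv (p u)) g) <= K * H g.
Proof.
have cv : (fun N => \sum_(u : W m) rho ^+ m.+1 * c u *
    green N (mul (inv (p u)) g)) @ \oo -->
    \sum_(u : W m) rho ^+ m.+1 * c u * H (mul (inv (p u)) g).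
  elim: (index_enum _) => [|u r IHr].
    by under eq_fun do rewrite big_nil; rewrite big_nil; exact: cvg_cst.
  under eq_fun do rewrite big_cons; rewrite big_cons; apply: cvgD => //.
  by apply: cvgM; [exact: cvg_cst|exact: green_cvg].
rewrite -(cvg_lim _ cv)//; apply: limr_le; first by apply/cvg_ex; eexists; exact: cv.
apply: nearW => N; apply: le_trans (green_superharmonic _ _ _) _.
rewrite ler_pM2l//; exact: nondecreasing_cvgn_le.
Qed.

(** The exponential inequality for [chi] is applied to the words of index [m]. Those with value in
    the commutator subgroup count with factor [expR 0]; the others are nonnegative and are
    dropped. *)
Lemma commutator_sum_le m : amenable R mul inv ->
  \sum_(w : W m | `[< in_commutator_subgroup mul inv e (p w) >]) c w
    <= K * rho ^- m.+1.
Proof.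
move=> am.
have Hgt0 g : 0 < H g.
  have [n [w [pw cw]]] := full g.
  apply: lt_le_trans (nondecreasing_cvgn_le (@green_nd g) (@green_cvg g) n.+1).
  rewrite /green big_ord_recr /= ltr_wpDl ?sumr_ge0//.
  rewrite mulr_gt0 ?exprn_gt0// /Z (bigD1 w) ?pw//= ltr_pwDl//.
  exact: sumr_ge0.
have [|chi [chiM chi_le]] := amenable_exponential_minorant grp am Hgt0.
  (* A Harnack constant for [s]: a single word of value [s] is kept in [H_superharmonic]. *)
  move=> s; have [n [w [pw cw]]] := full s.
  have a0 : 0 < rho ^+ n.+1 * c w by rewrite mulr_gt0 ?exprn_gt0.
  exists (K / (rho ^+ n.+1 * c w)) => g.
  rewrite mulrAC ler_pdivlMr// mulrC; apply: le_trans (H_superharmonic n g).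
  rewrite (bigD1 w)//= pw lerDl; apply: sumr_ge0 => u _.
  by rewrite !mulr_ge0 ?exprn_ge0 ?(ltW rho0)// ltW.
have {}chi_le := chi_le _ (@p m) (fun w => rho ^+ m.+1 * c w) K.
rewrite ler_pdivlMr ?exprn_gt0// mulrC.
apply: le_trans (chi_le _ (H_superharmonic m)); last first.
  by move=> i; rewrite mulr_ge0 ?exprn_ge0 ?(ltW rho0).
rewrite mulr_sumr [leRHS](bigID (fun w =>
  `[< in_commutator_subgroup mul inv e (p w) >]))/=.
rewrite -[leLHS]addr0 lerD//.
  apply: ler_sum => w /asboolP /(additive_commutator0 grp chiM) ->.
  by rewrite expR0 mulr1.
by apply: sumr_ge0 => w _; rewrite !mulr_ge0 ?expR_ge0 ?exprn_ge0 ?(ltW rho0).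
Qed.

End WeightedWords.

(** * Comparison of finite sums along an injection *)

Lemma ler_sum_inj (R : numDomainType) (I J : finType) (P : pred I) (Q : pred J)
    (h : I -> J) (F : J -> R) :
  injective h -> (forall j, 0 <= F j) -> (forall i, P i -> Q (h i)) ->
  \sum_(i | P i) F (h i) <= \sum_(j | Q j) F j.
Proof.
move=> hI F0 PQ.
rewrite -(big_imset (A := [pred i | P i]) F) /=; last by move=> i j _ _ /hI.
rewrite [leRHS](bigID (mem (h @: [pred i | P i]))) /=.
rewrite (eq_bigl (fun j => Q j && (j \in h @: [pred i | P i]))).
  by rewrite lerDl sumr_ge0.
move=> j; case: imsetP => [[i Pi ->]|]; last by rewrite andbF.
by rewrite PQ.
Qed.

(** * Shifts and cocycles on the subshift *)

Section Subshift.
Variables (k : nat) (A : rel 'I_k).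
Implicit Types (x y : nat -> 'I_k) (b : 'I_k).

Lemma shiftnD m n x : shiftn m (shiftn n x) = shiftn (m + n) x.
Proof. by apply/funext => i; rewrite /shiftn addnA. Qed.

Lemma shiftn0 x : shiftn 0 x = x.
Proof. by apply/funext => i; rewrite /shiftn addn0. Qed.

Lemma in_sft_shiftn n x : in_sft A x -> in_sft A (shiftn n x).
Proof. by move=> Ax i; rewrite /shiftn addSn. Qed.

Section Cocycle.
Variables (G : Type) (mul : G -> G -> G) (inv : G -> G) (e : G).
Hypothesis grp : is_group mul inv e.
Variable psi : 'I_k -> 'I_k -> G.
Local Notation cocycle := (cocycle mul e psi).

Lemma cocycleD m n x :
  cocycle (m + n) x = mul (cocycle m x) (cocycle n (shiftn m x)).
Proof.
elim: m x => [|m IHm] x; first by rewrite shiftn0 (grp_mul1 grp).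
by rewrite addSn /= IHm shiftnD addn1 (grp_assoc grp).
Qed.

(** The bound is [i <= n] because the last factor reads coordinate [n] as well. *)
Lemma eq_cocycle n x y : (forall i, (i <= n)%N -> x i = y i) ->
  cocycle n x = cocycle n y.
Proof.
elim: n x y => [//|n IHn] x y xy /=.
rewrite !xy//; congr mul; apply: IHn => i lein.
by rewrite /shiftn xy// addn1.
Qed.

End Cocycle.

(** * Periodic words and their concatenation *)

Section PeriodicWords.

Lemma periodic_ext_small n (w : {ffun 'I_n.+1 -> 'I_k}) i (lti : (i < n.+1)%N) :
  periodic_ext w i = w (Ordinal lti).
Proof. by congr (w _); apply: val_inj; rewrite /= modn_small. Qed.

Lemma eq_periodic_ext n (w : {ffun 'I_n.+1 -> 'I_k}) i j :
  i = j %[mod n.+1] -> periodic_ext w i = periodic_ext w j.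
Proof. by move=> ij; congr (w _); apply: val_inj. Qed.

Lemma periodic_ext_period n (w : {ffun 'I_n.+1 -> 'I_k}) :
  periodic_ext w n.+1 = periodic_ext w 0.
Proof. by apply: eq_periodic_ext; rewrite modnn. Qed.

(** One period suffices; the case [i = n] is the transition from the last letter back to the
    first. *)
Lemma in_sft_periodic n (w : {ffun 'I_n.+1 -> 'I_k}) :
  (forall i, (i <= n)%N -> A (periodic_ext w i) (periodic_ext w i.+1)) ->
  in_sft A (periodic_ext w).
Proof.
move=> Aw i.
rewrite (@eq_periodic_ext _ w i (i %% n.+1)) ?modn_mod//.
rewrite (@eq_periodic_ext _ w i.+1 (i %% n.+1).+1).
  by apply: Aw; rewrite -ltnS ltn_pmod.
by rewrite -[i.+1]addn1 -[(_ %% _).+1]addn1 modnDml.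
Qed.

(** Letters are read through [periodic_ext], at natural indices, which avoids ordinal bounds. *)
Definition cat_word m n (u : {ffun 'I_m.+1 -> 'I_k}) (v : {ffun 'I_n.+1 -> 'I_k})
    : {ffun 'I_(m + n).+2 -> 'I_k} :=
  [ffun i : 'I_(m + n).+2 =>
    if (i < m.+1)%N then periodic_ext u i else periodic_ext v (i - m.+1)].

Section Cat.
Variables (m n : nat) (u : {ffun 'I_m.+1 -> 'I_k}) (v : {ffun 'I_n.+1 -> 'I_k}).

Lemma cat_word_lt i : (i < m.+1)%N ->
  periodic_ext (cat_word u v) i = periodic_ext u i.
Proof.
move=> lti; have lti' : (i < (m + n).+2)%N by lia.
by rewrite periodic_ext_small ffunE /= lti.
Qed.

Lemma cat_word_ge i : (i < n.+1)%N ->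
  periodic_ext (cat_word u v) (i + m.+1) = periodic_ext v i.
Proof.
move=> lti; have lti' : (i + m.+1 < (m + n).+2)%N by lia.
by rewrite periodic_ext_small ffunE /= ltnNge leq_addl /= addnK.
Qed.

Hypothesis uv : periodic_ext u 0 = periodic_ext v 0.

(** The common first letter extends the agreement to one coordinate past the end of [u], as
    [eq_cocycle] requires. *)
Lemma cat_word_le i : (i <= m.+1)%N ->
  periodic_ext (cat_word u v) i = periodic_ext u i.
Proof.
rewrite leq_eqVlt => /predU1P[->|]; last exact: cat_word_lt.
by rewrite -[X in periodic_ext (cat_word _ _) X]add0n cat_word_ge// -uv
  periodic_ext_period.
Qed.

Lemma cat_word_shift_le i : (i <= n.+1)%N ->
  shiftn m.+1 (periodic_ext (cat_word u v)) i = periodic_ext v i.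
Proof.
rewrite leq_eqVlt => /predU1P[->|]; last exact: cat_word_ge.
rewrite /shiftn periodic_ext_period -uv -(@cat_word_lt 0)//.
by rewrite -periodic_ext_period; congr periodic_ext; lia.
Qed.

Lemma in_sft_cat_word : in_sft A (periodic_ext u) -> in_sft A (periodic_ext v) ->
  in_sft A (periodic_ext (cat_word u v)).
Proof.
move=> Au Av; apply: in_sft_periodic => i lei.
have [im|mi] := ltnP i m.+1; first by rewrite !cat_word_le// ltnW.
have -> : i = (i - m.+1 + m.+1)%N by lia.
have h j : (j <= n.+1)%N ->
   periodic_ext (cat_word u v) (j + m.+1) = periodic_ext v j.
  exact: cat_word_shift_le.
have h1 := h (i - m.+1)%N; have h2 := h (i - m.+1).+1.
by rewrite h1 ?h2; [exact: Av|lia|lia].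
Qed.

End Cat.

Lemma cat_word_inj m n (u u' : {ffun 'I_m.+1 -> 'I_k})
    (v v' : {ffun 'I_n.+1 -> 'I_k}) :
  cat_word u v = cat_word u' v' -> u = u' /\ v = v'.
Proof.
move=> eq; split; apply/ffunP => -[i lti]; rewrite -!periodic_ext_small.
  by rewrite -(cat_word_lt u v)// eq cat_word_lt.
by rewrite -(cat_word_ge u v)// eq cat_word_ge.
Qed.

End PeriodicWords.

(** * Birkhoff sums and bounded distortion *)

Section Potential.
Variables (R : realType) (f : (nat -> 'I_k) -> R).

Lemma birkhoffD m n x :
  birkhoff f (m + n) x = birkhoff f m x + birkhoff f n (shiftn m x).
Proof.
rewrite /birkhoff big_split_ord /=; congr (_ + _).
by apply: eq_bigr => i _; rewrite shiftnD addnC.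
Qed.

(** After [i] shifts the points still agree on [n - i] coordinates, so the differences are dominated
    by a geometric series whose sum does not depend on [n]. *)
Lemma holder_distortion : holder A f -> exists D : R, forall n x y,
  in_sft A x -> in_sft A y -> (forall i, (i < n)%N -> x i = y i) ->
  `|birkhoff f n x - birkhoff f n y| <= D.
Proof.
move=> [C [theta [/andP[t0 t1] fC]]]; exists (`|C| / (1 - theta)) => n x y Ax Ay xy.
rewrite /birkhoff -sumrB (le_trans (ler_norm_sum _ _ _))//.
(* The sign of [C] is not assumed. Lowering the exponent to [n - i.+1] makes index reversal give
   exactly [theta ^+ i]. *)
apply: (@le_trans _ _ (\sum_(i < n) `|C| * theta ^+ (n - i.+1))).
  apply: ler_sum => i _.
  apply: le_trans (fC (n - i)%N _ _ _ _ _) _; [exact: in_sft_shiftn..| |].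
    by move=> j ltj; apply: xy; rewrite addnC -ltn_subRL.
  apply: (@le_trans _ _ (`|C| * theta ^+ (n - i))).
    by rewrite ler_pM2r ?exprn_gt0// ler_norm.
  by rewrite ler_wpM2l// ler_wiXn2l ?(ltW t0) ?(ltW t1)//; lia.
rewrite (reindex_inj rev_ord_inj) /=.
rewrite (eq_bigr (fun i : 'I_n => `|C| * theta ^+ i)); last first.
  by move=> i _; congr (_ * _ ^+ _); have := ltn_ord i; lia.
rewrite -(big_mkord xpredT (fun i => `|C| * theta ^+ i)).
by apply: geometric_le_lim => //; rewrite gtr0_norm.
Qed.

(** * Weighted loops at a fixed symbol *)

Section Loops.
Variables (G : eqType) (mul : G -> G -> G) (inv : G -> G) (e : G).
Hypothesis grp : is_group mul inv e.
Variable psi : 'I_k -> 'I_k -> G.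
Local Notation word n := {ffun 'I_n.+1 -> 'I_k}.

Definition loop_value n (w : word n) : G :=
  cocycle mul e psi n.+1 (periodic_ext w).

(** Weight 0 for words that are not admissible loops at [b] lets sums range over all words, as in
    the abstract setting of weighted words. *)
Definition loop_weight b n (w : word n) : R :=
  if `[< in_sft A (periodic_ext w) /\ periodic_ext w 0 = b >]
  then expR (birkhoff f n.+1 (periodic_ext w)) else 0.

Lemma loop_weight_ge0 b n (w : word n) : 0 <= loop_weight b w.
Proof. by rewrite /loop_weight; case: ifP; rewrite ?expR_ge0. Qed.

Lemma loop_weight_gt0 b n (w : word n) :
  in_sft A (periodic_ext w) -> periodic_ext w 0 = b -> 0 < loop_weight b w.
Proof. by move=> Aw w0; rewrite /loop_weight asboolT// expR_gt0. Qed.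

Lemma loop_value_cat m n (u : word m) (v : word n) :
  periodic_ext u 0 = periodic_ext v 0 ->
  loop_value (cat_word u v) = mul (loop_value u) (loop_value v).
Proof.
move=> uv; have cD x : cocycle mul e psi (m + n).+2 x =
    mul (cocycle mul e psi m.+1 x) (cocycle mul e psi n.+1 (shiftn m.+1 x)).
  by rewrite -(cocycleD grp) addSn addnS.
rewrite /loop_value cD; congr mul.
  by apply: eq_cocycle => i lei; rewrite cat_word_le.
by apply: eq_cocycle => i lei; rewrite cat_word_shift_le.
Qed.

(** Nonzero weights make both words admissible loops at [b]. Each half of the concatenation costs
    one distortion constant, whence [expR (D + D)]. *)
Lemma loop_weight_cat : holder A f -> exists2 K : R, 0 < K &
  forall b m n (u : word m) (v : word n),
    loop_weight b u != 0 -> loop_weight b v != 0 ->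
    loop_weight b u * loop_weight b v <= K * loop_weight b (cat_word u v).
Proof.
move=> /holder_distortion[D hD]; exists (expR (D + D)); first exact: expR_gt0.
move=> b m n u v; rewrite {1 3}/loop_weight.
case: ifPn; last by rewrite eqxx.
move=> /asboolP[Au u0] _; rewrite {1 2}/loop_weight.
case: ifPn; last by rewrite eqxx.
move=> /asboolP[Av v0] _.
have uv : periodic_ext u 0 = periodic_ext v 0 by rewrite u0 v0.
have Auv := in_sft_cat_word uv Au Av.
rewrite /loop_weight asboolT; last by split => //; rewrite cat_word_lt.
have bD x : birkhoff f (m + n).+2 x =
    birkhoff f m.+1 x + birkhoff f n.+1 (shiftn m.+1 x).
  by rewrite -birkhoffD addSn addnS.
rewrite -!expRD ler_expR bD.
have h1 : `|birkhoff f m.+1 (periodic_ext (cat_word u v)) -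
           birkhoff f m.+1 (periodic_ext u)| <= D.
  by apply: hD => // i lti; rewrite cat_word_lt.
have h2 : `|birkhoff f n.+1 (shiftn m.+1 (periodic_ext (cat_word u v))) -
           birkhoff f n.+1 (periodic_ext v)| <= D.
  apply: hD => //; first exact: in_sft_shiftn.
  by move=> i lti; rewrite cat_word_shift_le// ltnW.
by move: h1 h2; rewrite !ler_norml; lra.
Qed.

Lemma loop_supermul (K : R) b m n g :
  (forall m n (u : word m) (v : word n),
    loop_weight b u != 0 -> loop_weight b v != 0 ->
    loop_weight b u * loop_weight b v <= K * loop_weight b (cat_word u v)) ->
  0 < K ->
  \sum_(u : word m) loop_weight b u *
     (\sum_(v : word n | loop_value v == mul (inv (loop_value u)) g)
        loop_weight b v)
  <= K * \sum_(w : word (m + n).+1 | loop_value w == g) loop_weight b w.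
Proof.
move=> hK K0.
under eq_bigr do rewrite mulr_sumr.
rewrite pair_big_dep /=.
(* Only pairs of genuine loops at [b] remain; on them concatenation multiplies values, and it is
   injective. *)
rewrite (bigID (fun uv => (loop_weight b uv.1 != 0) && (loop_weight b uv.2 != 0))) /=.
rewrite [X in _ + X]big1 ?addr0; last first.
  move=> [u v] /=; case/andP => _; rewrite negb_and !negbK.
  by case/orP => /eqP ->; rewrite ?mul0r ?mulr0.
apply: (@le_trans _ _ (\sum_(uv : word m * word n |
   (loop_value uv.2 == mul (inv (loop_value uv.1)) g) &&
   ((loop_weight b uv.1 != 0) && (loop_weight b uv.2 != 0)))
   K * loop_weight b (cat_word uv.1 uv.2))).
  by apply: ler_sum => -[u v] /= /and3P[_ u0 v0]; exact: hK.
rewrite -mulr_sumr ler_pM2l//.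
apply: (@ler_sum_inj _ _ _ _ _ (fun uv => cat_word uv.1 uv.2) (@loop_weight b _)).
- by move=> [u v] [u' v'] /cat_word_inj[/= -> ->].
- exact: loop_weight_ge0.
move=> [u v] /= /and3P[/eqP pv]; rewrite /loop_weight.
case: ifPn => [/asboolP[_ u0] _|]; last by rewrite eqxx.
case: ifPn => [/asboolP[_ v0] _|]; last by rewrite eqxx.
by rewrite loop_value_cat ?u0 ?v0// pv (mulKVg grp).
Qed.

(** Transitivity may give return time 0, which is not a word. The value sought is therefore that of
    [w0] inverted times [g], and [w0] is prepended; at time 0, [w0] alone has value [g]. *)
Lemma loop_full b n0 (w0 : word n0) :
  skew_transitive A mul e psi -> 0 < loop_weight b w0 ->
  forall g, exists n (w : word n), loop_value w = g /\ 0 < loop_weight b w.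
Proof.
move=> tr; rewrite {1}/loop_weight; case: ifPn; last by rewrite ltxx.
move=> /asboolP[Aw w0b] _ g.
have ex : exists x, in_sft A x /\ in_cyl 1 (fun=> b) x.
  by exists (periodic_ext w0); split => // -[].
have [[|n] [x [Ax xb xnb]]] :=
  tr 1%N (fun=> b) e 1%N (fun=> b) (mul (inv (loop_value w0)) g) ex ex.
  rewrite /= (grp_mul1 grp) => eg; exists n0, w0; split; last exact: loop_weight_gt0.
  by rewrite -[RHS](mulKVg grp (loop_value w0)) -eg (grp_mulg1 grp).
rewrite (grp_mul1 grp) => xg.
have {xb}x0 : x 0%N = b by exact: xb.
have {xnb}xn : x n.+1 = b by have := xnb 0%N isT; rewrite /shiftn add0n.
pose w : word n := [ffun i : 'I_n.+1 => x i].
have wx i : (i <= n.+1)%N -> periodic_ext w i = x i.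
  rewrite leq_eqVlt => /predU1P[->|lti].
    by rewrite periodic_ext_period (@periodic_ext_small _ w 0)// ffunE xn x0.
  by rewrite periodic_ext_small ffunE.
have Aw' : in_sft A (periodic_ext w).
  by apply: in_sft_periodic => i lei; rewrite !wx// ltnW.
have eqw : periodic_ext w0 0 = periodic_ext w 0 by rewrite wx// x0.
exists (n0 + n).+1, (cat_word w0 w); split.
  rewrite loop_value_cat// {2}/loop_value (eq_cocycle _ _ _ wx) xg.
  exact: (mulKVg grp).
apply: loop_weight_gt0; first exact: in_sft_cat_word.
by rewrite cat_word_lt.
Qed.

(** Words are sorted by first letter: a given [w] contributes only for [b = periodic_ext w 0]. *)
Lemma periodic_sum_loops (H : G -> Prop) n :
  periodic_sum A mul e psi H f n =
  \sum_b \sum_(w : word n | `[< H (loop_value w) >]) loop_weight b w.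
Proof.
rewrite exchange_big /= /periodic_sum big_mkcond [RHS]big_mkcond /=.
apply: eq_bigr => w _; rewrite /loop_value asbool_and andbC.
case: asboolP => [_|_]//=.
rewrite (bigD1 (periodic_ext w 0))//= big1 ?addr0.
  rewrite /loop_weight; case: asboolP => [Aw|nAw]; first by rewrite asboolT.
  by rewrite asboolF// => -[].
by move=> b /eqP nb; rewrite /loop_weight asboolF// => -[_ /esym].
Qed.

End Loops.
End Potential.
End Subshift.

(** * Geometric bounds and exponential growth rates *)

Lemma eventually_geometric_bounded_sum (R : realType) (a : nat -> R) (z : R) N0 :
  0 < z < 1 -> (forall n, 0 <= a n) ->
  (forall n, (N0 <= n)%N -> a n <= z ^+ n.+1) ->
  exists B, forall N, \sum_(n < N) a n <= B.
Proof.
move=> /andP[z0 z1] a0 az.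
exists (\sum_(n < N0) a n + 1 / (1 - z)) => N.
apply: (@le_trans _ _ (\sum_(n < N0 + N) a n)).
  by rewrite addnC big_split_ord /= lerDl sumr_ge0.
rewrite big_split_ord /= lerD2l.
apply: (@le_trans _ _ (\sum_(n < N) 1 * z ^+ n)).
  apply: ler_sum => n _; rewrite mul1r (le_trans (az _ (leq_addr _ _)))//.
  by rewrite ler_wiXn2l ?(ltW z0) ?(ltW z1)//; lia.
rewrite -(big_mkord xpredT (fun i => 1 * z ^+ i)).
by apply: geometric_le_lim => //; rewrite gtr0_norm.
Qed.

Lemma lte_dense_real (R : realType) (x y : \bar R) :
  (x < y)%E -> exists2 r : R, (x < r%:E)%E & (r%:E < y)%E.
Proof.
case: x y => [x| |] [y| |] //=; rewrite ?lte_fin => xy.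
- by exists ((x + y) / 2); rewrite lte_fin; lra.
- by exists (x + 1); rewrite ?ltry// lte_fin; lra.
- by exists (y - 1); rewrite ?ltNyr// lte_fin; lra.
- by exists 0; rewrite ?ltNyr ?ltry.
Qed.

Section Growth.
Variables (R : realType) (Z : nat -> R).
Let u n := if 0 < Z n then ((ln (Z n)) / n.+1%:R)%:E else -oo%E.

Lemma limn_esup_log_lt (r : R) : (limn_esup u < r%:E)%E ->
  exists N, forall n, (N <= n)%N -> Z n <= expR r ^+ n.+1.
Proof.
move=> /ereal_inf_lt[_ [V [N _ NV] <-]] ltr; exists N => n /NV Vn.
have : (u n < r%:E)%E by apply: le_lt_trans ltr; apply: ereal_sup_ubound; exists n.
rewrite /u; case: ifPn => [Zn|]; last first.
  by rewrite -leNgt => Zn _; rewrite (le_trans Zn)// exprn_ge0// expR_ge0.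
rewrite lte_fin ltr_pdivrMr// => /ltW lnZ.
by rewrite -expRM_natr -[leLHS]lnK ?posrE// ler_expR.
Qed.

(** The gap [s - r] absorbs the constant: [ln C <= (s - r) * n.+1%:R] for all large [n]. *)
Lemma limn_esup_log_le (r s C : R) : 0 < C -> r < s ->
  (forall n, Z n <= C * expR r ^+ n.+1) -> (limn_esup u <= s%:E)%E.
Proof.
move=> C0 rs ZC.
have sr0 : 0 < s - r by rewrite subr_gt0.
pose N := Num.bound `|ln C / (s - r)|.
apply: (@le_trans _ _ (ereal_sup [set u n | n in [set n | (N <= n)%N]])).
  by apply: ereal_inf_lbound; exists [set n | (N <= n)%N] => //; exists N.
apply: ge_ereal_sup => _ [n /= Nn <-]; rewrite /u.
case: ifPn => [Zn|_]; last exact: leNye.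
rewrite lee_fin ler_pdivrMr//.
have : ln (Z n) <= ln C + r * n.+1%:R.
  rewrite -ler_expR expRD !lnK ?posrE// expRM_natr.
  exact: ZC.
have : ln C <= (s - r) * n.+1%:R.
  rewrite mulrC -ler_pdivrMr// (le_trans (ler_norm _))//.
  by rewrite (le_trans (ltW (archi_boundP (normr_ge0 _))))// ler_nat leqW.
lra.
Qed.

End Growth.

Lemma limn_esup_le (R : realType) (u v : (\bar R)^nat) :
  (forall n, (u n <= v n)%E) -> (limn_esup u <= limn_esup v)%E.
Proof.
move=> uv; apply: le_ereal_inf_tmp => _ [V VN <-].
apply: le_trans (_ : ereal_sup [set u n | n in V] <= _)%E.
  by apply: ereal_inf_lbound; exists V.
apply: ge_ereal_sup => _ [n Vn <-]; apply: le_trans (uv n) _.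
by apply: ereal_sup_ubound; exists n.
Qed.

(** * Comparison of the two periodic sums and of the pressures *)

Lemma commutator_periodic_sum_le (R : realType) (k : nat) (A : rel 'I_k)
    (G : eqType) (mul : G -> G -> G) (inv : G -> G) (e : G)
    (psi : 'I_k -> 'I_k -> G) (f : (nat -> 'I_k) -> R) (r s : R) (N : nat) :
  is_group mul inv e -> skew_transitive A mul e psi -> holder A f ->
  amenable R mul inv -> r < s ->
  (forall n, (N <= n)%N ->
     periodic_sum A mul e psi (fun g => g = e) f n <= expR r ^+ n.+1) ->
  exists2 C : R, 0 < C & forall n,
    periodic_sum A mul e psi (in_commutator_subgroup mul inv e) f n
      <= C * expR s ^+ n.+1.
Proof.
move=> grp tr hf am rs hr.
have [K K0 hK] := loop_weight_cat hf.
(* As [r < s], the series of identity loops weighted by powers of [rho] is eventually dominated by a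
   geometric series of ratio [expR (r - s)]. *)
pose rho := expR (- s).
have rho0 : 0 < rho by exact: expR_gt0.
have loop_le b n : \sum_(w : {ffun 'I_n.+1 -> 'I_k} |
      `[< in_commutator_subgroup mul inv e (loop_value mul e psi w) >])
      loop_weight A f b w <= K * expR s ^+ n.+1.
  (* Without a loop at [b] the sum is 0; otherwise one loop [w0] suffices for [loop_full]. *)
  have [[n0 [w0 w0b]]|nob] :=
    pselect (exists n (w : {ffun 'I_n.+1 -> 'I_k}), 0 < loop_weight A f b w); last first.
    rewrite big1 ?mulr_ge0 ?exprn_ge0 ?expR_ge0 ?(ltW K0)// => w _.
    apply/eqP; rewrite eq_le loop_weight_ge0 andbT leNgt; apply/negP => w0.
    by apply: nob; exists n, w.
  pose a n := rho ^+ n.+1 *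
    \sum_(w : {ffun 'I_n.+1 -> 'I_k} | loop_value mul e psi w == e)
       loop_weight A f b w.
  have [| | |B hB] := @eventually_geometric_bounded_sum _ a (expR (r - s)) N.
  - by rewrite expR_gt0 expR_lt1 subr_lt0.
  - move=> m; rewrite mulr_ge0 ?exprn_ge0 ?(ltW rho0)//.
    by apply: sumr_ge0 => *; exact: loop_weight_ge0.
  - move=> m Nm; rewrite /a addrC expRD exprMn ler_pM2l ?exprn_gt0//.
    apply: le_trans (hr m Nm); rewrite periodic_sum_loops (bigD1 b)//=.
    rewrite (eq_bigl (fun w => `[< loop_value mul e psi w = e >])); last first.
      by move=> w; apply/eqP/asboolP.
    rewrite lerDl; apply: sumr_ge0 => i _.
    by apply: sumr_ge0 => *; exact: loop_weight_ge0.
  have -> : expR s ^+ n.+1 = rho ^- n.+1 by rewrite /rho expRN exprVn invrK.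
  apply: (@commutator_sum_le _ _ _ _ _ grp (fun n => {ffun 'I_n.+1 -> 'I_k})
    (fun n => @loop_value k G mul e psi n)
    (fun n => @loop_weight k A R f b n) K rho B) => //.
  - by move=> *; exact: loop_weight_ge0.
  - by move=> m m' g; apply: loop_supermul => // *; exact: hK.
  - exact: (loop_full grp tr w0b).
(* There are [k] symbols; [k.+1] keeps the constant positive even for [k = 0]. *)
exists (K * k.+1%:R); first by rewrite mulr_gt0.
move=> n; rewrite periodic_sum_loops.
apply: le_trans (ler_sum _ (fun b _ => loop_le b n)) _.
rewrite sumr_const card_ord -[leLHS]mulr_natr mulrAC ler_pM2r ?exprn_gt0 ?expR_gt0//.
by rewrite ler_pM2l// ler_nat.
Qed.

Theorem theorem5p1 (R : realType) (k : nat) (A : rel 'I_k)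
  (G : countType) (mul : G -> G -> G) (inv : G -> G) (e : G)
  (psi : 'I_k -> 'I_k -> G) (f : (nat -> 'I_k) -> R) :
  is_group mul inv e ->
  topologically_mixing A ->
  skew_transitive A mul e psi ->
  holder A f ->
  amenable R mul inv ->
  gurevic_pressure A mul e psi f = gurevic_pressure_ab A mul inv e psi f.
Proof.
move=> grp _ tr hf am; apply/eqP; rewrite eq_le; apply/andP; split.
  (* The easy inequality: [e] is an empty product of commutators. *)
  apply: limn_esup_le => n /=.
  have le_sum : periodic_sum A mul e psi (fun g => g = e) f n <=
      periodic_sum A mul e psi (in_commutator_subgroup mul inv e) f n.
    apply: (@ler_sum_inj _ _ _ _ _ id); [by []|by move=> w; exact: expR_ge0|].
    by move=> w /asboolP[Aw we]; apply/asboolP; split=> //; exists [::].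
  case: ifPn => [Z0|_]; last exact: leNye.
  have Z0' := lt_le_trans Z0 le_sum.
  by rewrite Z0' lee_fin ler_pM2r// ler_ln.
(* If the inequality failed, rates [r < s < t] would fit between the pressures: [r] bounds the
   identity sums, [s] makes the Green series converge, and [t] absorbs the constant [C], so the
   abelianized pressure is at most [t], a contradiction. *)
rewrite leNgt; apply/negP => /lte_dense_real[r Pr].
move=> /lte_dense_real[s]; rewrite lte_fin => rs /lte_dense_real[t].
rewrite lte_fin => st; apply/negP; rewrite -leNgt.
have [N hN] := limn_esup_log_lt Pr.
have [C C0 hC] := commutator_periodic_sum_le grp tr hf am rs hN.
exact: limn_esup_log_le C0 st hC.
Qed.
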